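(* For any projection algebra $P$, the free regular $*$-semigroup $\mathsf{PG}(P)$ has the semigroup presentation $$\mathsf{PG}(P)\cong\langle X_E:R_E\rangle,$$ where $X_E=\{x_e:e\in E\}$ is an alphabet in one-one correspondence with $E=\mathbf E(P)$, and where $R_E$ is the set of relations $$x_ex_f=x_{ef}\ \text{ for all }(e,f)\in\mathrm{BP}(E),\qquad x_px_q=x_{pq}\ \text{ for all }p,q\in P.$$
   Context: Maps are written to the right of their arguments and composed left to right. For a set $X$ and $R\subseteq X^+\times X^+$ (with $X^+$ the free semigroup on $X$), $\langle X:R\rangle$ denotes the semigroup $X^+/R^\sharp$, where $R^\sharp$ is the congruence on $X^+$ generated by $R$; a pair $(u,v)\in R$ is written $u=v$. A projection algebra is a set $P$ with unary operations $\theta_p:P\to P$ ($p\in P$) such that for all $p,q\in P$: $p\theta_p=p$; $\theta_p\theta_p=\theta_p$; $p\theta_q\theta_p=q\theta_p$; $\theta_p\theta_q\theta_p=\theta_{q\theta_p}$; $\theta_p\theta_q\theta_p\theta_q=\theta_p\theta_q$. On $P$ define $p\leq_{\mathscr F}q$ iff $p=q\theta_p$; $p\mathrel{\mathscr F}q$ iff $p\leq_{\mathscr F}q$ and $q\leq_{\mathscr F}p$. A $P$-path is a tuple $(p_1,\ldots,p_k)$ ($k\geq1$) with $p_1\mathrel{\mathscr F}\cdots\mathrel{\mathscr F}p_k$, regarded as a morphism $p_1\to p_k$; the path category $\mathscr P(P)$ consists of all $P$-paths under $(p_1,\ldots,p_k)\circ(p_k,\ldots,p_l)=(p_1,\ldots,p_k,\ldots,p_l)$,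 with identities $(p)$. A pair $(e,f)\in P\times P$ is $p$-linked ($p\in P$) if $f=e\theta_p\theta_f$ and $e=f\theta_p\theta_e$. Let $\equiv$ be the (category) congruence on $\mathscr P(P)$ generated by all pairs $((p,p),(p))$ with $p\in P$, all $((p,q,p),(p))$ with $p\mathrel{\mathscr F}q$, and all $((e,e\theta_p,f),(e,f\theta_p,f))$ with $p\in P$ and $(e,f)$ $p$-linked. The class of $(p_1,\ldots,p_k)$ is denoted $[\![p_1,\ldots,p_k]\!]$. The free (projection-generated) regular $*$-semigroup $\mathsf{PG}(P)$ consists of all these classes, with $[\![p_1,\ldots,p_k]\!]^*=[\![p_k,\ldots,p_1]\!]$ and product $[\![p_1,\ldots,p_k]\!]\cdot[\![q_1,\ldots,q_l]\!]=[\![p_1',\ldots,p_k',q_1',\ldots,q_l']\!]$, where, with $p'=q_1\theta_{p_k}$ and $q'=p_k\theta_{q_1}$, $p_i'=p'\theta_{p_k}\cdots\theta_{p_i}$ and $q_j'=q'\theta_{q_1}\cdots\theta_{q_j}$. The product of $\mathsf{PG}(P)$ is denoted here by juxtaposition. $E=\mathbf E(P)=\{[\![p,q]\!]:p\mathrel{\mathscr F}q\}$ is the set of all idempotents of $\mathsf{PG}(P)$, and $P\subseteq E$ via the identification $p=[\![p]\!]$. The set of basic pairs is $\mathrm{BP}(E)=\{(e,f)\in E\times E:\{e,f\}\cap\{ef,fe\}\neq\varnothing\}$; then $ef\in E$ for $(e,f)\in\mathrm{BP}(E)$. Also, for all $p,q\in P$, the product $pq$ in $\mathsf{PG}(P)$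 is an idempotent, hence an element of $E$. *)

(* Defs.v *)
From HB Require Import structures.
From mathcomp Require Import all_boot.
From mathcomp Require Import boolp.

Set Implicit Arguments.
Unset Strict Implicit.
Unset Printing Implicit Defensive.

Local Open Scope quotient_scope.
Local Open Scope group_scope.

Record equivalence (T : Type) (R : T -> T -> Prop) : Prop := Equivalence {
  eqv_refl : forall x, R x x;
  eqv_sym : forall x y, R x y -> R y x;
  eqv_trans : forall x y z, R x y -> R y z -> R x z }.

Section Quot.
Context (T : Type) (R : T -> T -> Prop) (eqR : equivalence R).

Definition quot_rel : rel {classic T} := fun x y => `[< R x y >].

Lemma quot_rel_refl : reflexive quot_rel.
Proof. by move=> x; apply/asboolP; apply: (eqv_refl eqR). Qed.

Lemma quot_rel_sym : symmetric quot_rel.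
Proof.
move=> x y; apply/idP/idP => /asboolP h; apply/asboolP;
by apply: (eqv_sym eqR).
Qed.

Lemma quot_rel_trans : transitive quot_rel.
Proof.
move=> y x z /asboolP h /asboolP h'; apply/asboolP.
exact: (eqv_trans eqR h h').
Qed.

Definition quot_equiv : equiv_rel {classic T} :=
  EquivRel quot_rel quot_rel_refl quot_rel_sym quot_rel_trans.

Definition quot : Type := {eq_quot quot_equiv}.
HB.instance Definition _ := Choice.copy quot {eq_quot quot_equiv}.

Definition cls (x : T) : quot := \pi_({eq_quot quot_equiv}) x.
Definition rep (c : quot) : T := repr (c : {eq_quot quot_equiv}).

Lemma repK (c : quot) : cls (rep c) = c.
Proof. exact: reprK. Qed.

Lemma clsP (x y : T) : cls x = cls y <-> R x y.
Proof.
split=> [/eqmodP /asboolP // | h].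
by apply/eqmodP; apply/asboolP.
Qed.

Lemma rep_cls (x : T) : R (rep (cls x)) x.
Proof. by apply/clsP; rewrite repK. Qed.

End Quot.

(* The nonempty word x_1 x_2 ... x_k is (x_1, [:: x_2; ...; x_k]). *)
Definition word (X : Type) : Type := (X * seq X)%type.

Section Words.
Context (X Y : Type).
Implicit Types (u v w : word X).

Definition letter (x : X) : word X := (x, [::]).
Definition letters2 (x y : X) : word X := (x, [:: y]).

Definition wcat u v : word X := (u.1, u.2 ++ v.1 :: v.2).

Definition wlast u : X := last u.1 u.2.
Definition wrev u : word X := (wlast u, rev (belast u.1 u.2)).

(* wscan f a (x_1 ... x_k) = y_1 ... y_k with y_1 = f a x_1 and
   y_{i+1} = f y_i x_{i+1}. *)
Definition wscan (f : Y -> X -> Y) (a : Y) u : word Y :=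
  (f a u.1, scanl f (f a u.1) u.2).

Lemma wcatA : associative wcat.
Proof. by move=> u v w; rewrite /wcat /= -catA. Qed.

End Words.

Section Presentation.
Context (X : Type).

Inductive gen_congr (R : word X -> word X -> Prop) : word X -> word X -> Prop :=
| gc_gen u v : R u v -> gen_congr R u v
| gc_refl u : gen_congr R u u
| gc_sym u v : gen_congr R u v -> gen_congr R v u
| gc_trans u v w : gen_congr R u v -> gen_congr R v w -> gen_congr R u w
| gc_mul u u' v v' : gen_congr R u u' -> gen_congr R v v' ->
    gen_congr R (wcat u v) (wcat u' v').

Context (R : word X -> word X -> Prop).

Lemma gen_congr_equiv : equivalence (gen_congr R).
Proof. split; [exact: gc_refl | exact: gc_sym | exact: gc_trans]. Qed.

Definition presented : Type := quot gen_congr_equiv.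
HB.instance Definition _ := Choice.copy presented (quot gen_congr_equiv).

Definition presented_cls (u : word X) : presented := cls gen_congr_equiv u.

Definition presented_mul (a b : presented) : presented :=
  presented_cls (wcat (rep a) (rep b)).

Lemma presented_mulE u v :
  presented_mul (presented_cls u) (presented_cls v) = presented_cls (wcat u v).
Proof. by apply/clsP; apply: gc_mul; apply: rep_cls. Qed.

Lemma presented_mulA : associative presented_mul.
Proof.
move=> a b c.
rewrite -[a]repK -[b]repK -[c]repK -!/(presented_cls _).
by rewrite !presented_mulE wcatA.
Qed.

HB.instance Definition _ := hasMul.Build presented presented_mul.
HB.instance Definition _ := Magma_isSemigroup.Build presented presented_mulA.

End Presentation.

Reserved Notation "x \th p" (at level 40, left associativity).

(* theta p x is x theta_p; with x \th p for theta p x, maps compose left to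
   right: x theta_p theta_q is x \th p \th q. *)
Record proj_algebra_axioms (P : Type) (theta : P -> P -> P)
    (act := fun x p => theta p x) : Prop := ProjAlgebraAxioms {
  pa_fix : forall p, act p p = p;
  pa_idem : forall p x, act (act x p) p = act x p;
  pa_conj : forall p q, act (act p q) p = act q p;
  pa_theta : forall p q x, act (act (act x p) q) p = act x (act q p);
  pa_idem2 : forall p q x,
    act (act (act (act x p) q) p) q = act (act x p) q }.

Record projAlgebra := ProjAlgebra {
  pa_sort :> Type;
  theta : pa_sort -> pa_sort -> pa_sort;
  pa_axioms : proj_algebra_axioms theta }.

Notation "x \th p" := (theta p x).

Section ProjAlgebraTheory.
Context (P : projAlgebra).
Implicit Types p q r e f x : P.

Lemma thpp p : p \th p = p.
Proof. exact: (pa_fix (pa_axioms P)). Qed.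
Lemma thI p x : x \th p \th p = x \th p.
Proof. exact: (pa_idem (pa_axioms P)). Qed.
Lemma thJ p q : p \th q \th p = q \th p.
Proof. exact: (pa_conj (pa_axioms P)). Qed.
Lemma thT p q x : x \th (q \th p) = x \th p \th q \th p.
Proof. by rewrite -(pa_theta (pa_axioms P)). Qed.
Lemma thI2 p q x : x \th p \th q \th p \th q = x \th p \th q.
Proof. exact: (pa_idem2 (pa_axioms P)). Qed.

(* Not the natural partial order p = p \th q of projections. *)
Definition leF p q : Prop := p = q \th p.

Definition relF : rel P := fun p q => `[< leF p q /\ leF q p >].

Definition linked p e f : Prop := f = e \th p \th f /\ e = f \th p \th e.

Lemma relFP p q : reflect (p = q \th p /\ q = p \th q) (relF p q).
Proof. exact: asboolP. Qed.

Lemma relF_refl p : relF p p.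
Proof. by apply/relFP; rewrite thpp. Qed.

Lemma relF_sym p q : relF p q = relF q p.
Proof. by apply/relFP/relFP => -[]. Qed.

Lemma relF_th p q : relF (q \th p) (p \th q).
Proof.
by apply/relFP; rewrite !thT !thI2 !thJ.
Qed.

Lemma linkedC p e f : linked p e f -> linked p f e.
Proof. by case. Qed.

Lemma linked_relF p e f : linked p e f -> relF e (e \th p).
Proof.
case=> hf he; apply/relFP; rewrite thT !thJ; split=> //.
have -> : p \th e = p \th (f \th p \th e) by rewrite -he.
by rewrite !thT thJ -hf -he.
Qed.


Lemma linked_relF2 p e f : linked p e f -> relF (e \th p) f.
Proof. by case=> hf he; apply/relFP; rewrite thT -he -hf. Qed.

Lemma relF_back p q r : relF p q -> r = r \th p -> r \th q \th p = r.
Proof. by case/relFP=> hp _ hr; rewrite {1}hr -thT -hp -hr. Qed.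

Lemma relF_restr p q r : relF p q -> r = r \th p -> relF r (r \th q).
Proof.
move=> hpq hr; have hr' := esym hr; have E1 := relF_back hpq hr.
have E2 : r \th q \th r = r by rewrite -{1}hr' thT E1 thpp.
by apply/relFP; rewrite thT E2.
Qed.

Lemma linked_restr p e f r : linked p e f -> r = r \th f ->
  let e' := r \th p \th e in
  [/\ r \th (e \th p) = e' \th p, r \th (f \th p) = r \th p,
      e' \th p \th e = e' & linked p e' r].
Proof.
case=> hf he hr /=; have hr' := esym hr.
rewrite !thT.
have h1 : r \th p \th e \th p \th r = r.
  rewrite -thT thJ -{1}hr' thT -hf thJ.
  exact: hr'.
split=> //; first by rewrite -{1}hr' thI2 hr'.
  by rewrite thI2.
by split; rewrite ?h1 // !thT h1.
Qed.

End ProjAlgebraTheory.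

Section PathCategory.
Context (P : projAlgebra).
Implicit Types (p q r e f : P) (u v w : word P).

Definition act : P -> P -> P := fun x p => x \th p.

Definition chain w : bool := path (@relF P) w.1 w.2.

Record ppath := PPath { pword :> word P; pwordP : chain pword }.
Implicit Types a b c : ppath.

Definition pdom a : P := (a : word P).1.
Definition pcod a : P := wlast a.

(* (p_1, ..., p_k) o (p_k, ..., p_l) = (p_1, ..., p_k, ..., p_l) *)
Definition wcomp u v : word P := (u.1, u.2 ++ v.2).

Lemma chain_comp a b : pcod a = pdom b -> chain (wcomp a b).
Proof.
case: a b => -[x s] /= hs [] [y t] /= ht; rewrite /pcod /pdom /wlast /= => h.
by rewrite /chain /= cat_path h; apply/andP.
Qed.

Definition pcomp a b (h : pcod a = pdom b) : ppath := PPath (chain_comp h).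

Lemma chain1 p : chain (letter p). Proof. by []. Qed.
Lemma chain2 p q : relF p q -> chain (letters2 p q).
Proof. by rewrite /chain /= andbT. Qed.

Definition path1 p : ppath := PPath (chain1 p).
Definition path2 p q (h : relF p q) : ppath := PPath (chain2 h).

Inductive path_rel : word P -> word P -> Prop :=
| pr_id p : path_rel (p, [:: p]) (p, [::])
| pr_back p q : relF p q -> path_rel (p, [:: q; p]) (p, [::])
| pr_linked p e f : linked p e f ->
    path_rel (e, [:: e \th p; f]) (e, [:: f \th p; f]).

Lemma path_rel_chain u v : path_rel u v -> chain u /\ chain v.
Proof.
case=> [p|p q h|p e f h]; rewrite /chain /= ?relF_refl //.
  by rewrite h relF_sym h.
have hl := linkedC h.
rewrite (linked_relF h) (linked_relF2 h) relF_sym (linked_relF2 hl).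
by rewrite relF_sym (linked_relF hl).
Qed.

Inductive pcongr : ppath -> ppath -> Prop :=
| pc_gen a b : path_rel a b -> pcongr a b
| pc_refl a : pcongr a a
| pc_sym a b : pcongr a b -> pcongr b a
| pc_trans a b c : pcongr a b -> pcongr b c -> pcongr a c
| pc_comp a a' b b' (h : pcod a = pdom b) (h' : pcod a' = pdom b') :
    pcongr a a' -> pcongr b b' -> pcongr (pcomp h) (pcomp h').

Lemma pcongr_equiv : equivalence pcongr.
Proof. split; [exact: pc_refl | exact: pc_sym | exact: pc_trans]. Qed.

Lemma ppath_inj a b : pword a = pword b -> a = b.
Proof.
case: a b => u hu [v hv] /= e; case: _ / e hv => hv.
by rewrite (bool_irrelevance hu hv).
Qed.

Lemma pcongr_ends a b : pcongr a b -> pdom a = pdom b /\ pcod a = pcod b.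
Proof.
elim=> {a b} [a b|a|a b _ [-> ->]|a b c _ [-> ->] _ [-> ->]|] //.
  by rewrite /pdom /pcod; case.
move=> a a' b b' h h' _ [h1 h2] _ [h3 h4]; split=> //.
move: h h' h4; rewrite /pcod /wlast /= /wcomp /= !last_cat.
by rewrite /pdom /= /wlast => -> ->.
Qed.

Lemma wrevK : involutive (@wrev P).
Proof.
case=> x s; rewrite /wrev /wlast /=; elim/last_ind: s => [|s y _] //=.
by rewrite last_rcons belast_rcons rev_cons last_rcons belast_rcons rev_cons
  revK.
Qed.

Lemma wlast_rev u : wlast (wrev u) = u.1.
Proof. by rewrite -{2}[u]wrevK. Qed.

Lemma chain_rev u : chain (wrev u) = chain u.
Proof.
rewrite /chain /wrev /wlast /= rev_path.
by apply: eq_path => x y; rewrite relF_sym.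
Qed.

Lemma wrev_comp u v : wlast u = v.1 -> wrev (wcomp u v) = wcomp (wrev v) (wrev u).
Proof.
case: u v => x s [y t]; rewrite /wcomp /wrev /wlast /= => <-.
by rewrite last_cat belast_cat rev_cat.
Qed.

Definition ppath_rev a : ppath := PPath (etrans (chain_rev a) (pwordP a)).

Lemma path_rel_rev u v : path_rel u v ->
  path_rel (wrev u) (wrev v) \/ path_rel (wrev v) (wrev u).
Proof.
case=> [p|p q h|p e f h]; [left; exact: pr_id|left; exact: pr_back|right].
exact: pr_linked (linkedC h).
Qed.

Lemma pcongr_rev a b : pcongr a b -> pcongr (ppath_rev a) (ppath_rev b).
Proof.
elim=> {a b} [a b /path_rel_rev[h|h]|a|a b _|a b c _ + _|].
- exact: pc_gen.
- by apply/pc_sym/pc_gen.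
- exact: pc_refl.
- exact: pc_sym.
- exact: pc_trans.
move=> a a' b b' h h' _ ha _ hb.
have e c d : pcod c = pdom d -> pcod (ppath_rev d) = pdom (ppath_rev c).
  by rewrite /pcod /pdom /= wlast_rev.
have ec c d (g : pcod c = pdom d) : ppath_rev (pcomp g) = pcomp (e c d g).
  by apply: ppath_inj; apply: wrev_comp.
by rewrite !ec; apply: pc_comp.
Qed.

Lemma chain_scan r u : r = r \th u.1 -> chain u ->
  chain (wscan act r u) /\ wlast (wscan act r u) = wlast (wscan act r u) \th wlast u.
Proof.
case: u => x s /=; rewrite /chain /wlast /wscan /= /act => hr; rewrite -hr.
elim: s x r hr => [|y s IH] x r hr //= /andP[hxy hs].
have [h1 h2] := IH y (r \th y) (esym (thI y r)) hs.
by split=> //; rewrite h1 (relF_restr hxy hr).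
Qed.

Lemma wscan_comp r u v : wlast u = v.1 -> r = r \th u.1 -> chain u ->
  wscan act r (wcomp u v) = wcomp (wscan act r u) (wscan act (wlast (wscan act r u)) v).
Proof.
case: u v => x s [y t] + hr hu; have [_] := chain_scan hr hu.
rewrite /wcomp /wscan /wlast /= -/(act _ (last x s)) => + <- => <-.
rewrite scanl_cat; congr (_, _ ++ scanl _ _ _).
by elim: s (act r x) {hr hu} => //= z s IH r'; rewrite IH.
Qed.

Lemma path_rel_restr r u v : path_rel u v -> r = r \th u.1 ->
  path_rel (wscan act r u) (wscan act r v).
Proof.
case=> [p|p q h|p e f h] /= hr; rewrite /wscan /= /act -!hr.
- exact: pr_id.
- by rewrite (relF_back h hr); apply/pr_back; exact: (relF_restr h hr).
have [-> -> -> h'] := linked_restr (linkedC h) hr.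
exact: pr_linked (linkedC h').
Qed.

Lemma pcongr_restr a b : pcongr a b -> forall r a' b', r = r \th pdom a ->
  pword a' = wscan act r a -> pword b' = wscan act r b -> pcongr a' b'.
Proof.
elim=> {a b} [a b|a|a b h IH|a b c|].
- move=> h r a' b' hr ha hb; apply: pc_gen; rewrite ha hb.
  exact: path_rel_restr.
- by move=> r a' b' _ ha hb; rewrite (ppath_inj (etrans ha (esym hb))); apply: pc_refl.
- move=> r a' b' hr ha hb; apply: pc_sym (IH r b' a' _ hb ha).
  by rewrite (pcongr_ends h).1.
- move=> h IH _ IH' r a' c' hr ha hc.
  have hr' : r = r \th pdom b by rewrite -(pcongr_ends h).1.
  have [hb _] := chain_scan hr' (pwordP b).
  by apply: (pc_trans (IH r a' (PPath hb) _ _ _) (IH' r (PPath hb) c' _ _ _)).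
move=> a a' b b' h h' ha IHa hb IHb r c c' hr hc hc'.
have [ea1 ea2] := pcongr_ends ha.
have hr' : r = r \th pdom a' by rewrite -ea1.
have [k e] := chain_scan (u := a) hr (pwordP a).
have [k' _] := chain_scan hr' (pwordP a').
have ka := IHa r (PPath k) (PPath k') hr erefl erefl.
have [_ ee] := pcongr_ends ka; rewrite /pcod /= in ee.
set r1 := wlast (wscan act r a) in e ee.
have hr1 : r1 = r1 \th pdom b by rewrite -h.
have hr1' : r1 = r1 \th pdom b' by rewrite -(pcongr_ends hb).1.
have [l _] := chain_scan hr1 (pwordP b).
have [l' _] := chain_scan hr1' (pwordP b').
have lb := IHb r1 (PPath l) (PPath l') hr1 erefl erefl.
have j : pcod (PPath k) = pdom (PPath l) by rewrite /pdom /= /act -hr1.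
have j' : pcod (PPath k') = pdom (PPath l') by rewrite /pdom /= /act -hr1' /pcod /= -ee.
have -> : c = pcomp j.
  by apply: ppath_inj; rewrite hc /= wscan_comp ?(pwordP a).
have -> : c' = pcomp j'.
  by apply: ppath_inj; rewrite hc' /= wscan_comp -?ee ?(pwordP a').
exact: pc_comp.
Qed.

(* p_i' = p' theta_{p_k} ... theta_{p_i} is a scan over the reversed word
   p_k ... p_1, and q_j' = q' theta_{q_1} ... theta_{q_j} one over q_1 ... q_l. *)
Definition pmul_word u v : word P :=
  let p' := v.1 \th wlast u in
  let q' := wlast u \th v.1 in
  wcat (wrev (wscan act p' (wrev u))) (wscan act q' v).

Lemma pmul_wordE u v (p' := v.1 \th wlast u) (q' := wlast u \th v.1) :
  pmul_word u v = wcomp (wcomp (wrev (wscan act p' (wrev u))) (letters2 p' q'))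
                        (wscan act q' v).
Proof.
rewrite /pmul_word /wcat /wcomp /= -catA /=; congr (_, _ ++ _ :: _).
by rewrite /act thI.
Qed.

Section ProductFactors.
Context (a b : ppath).

Lemma rscan_chain r : r = r \th pdom b -> chain (wscan act r b).
Proof. by move=> hr; have [] := chain_scan hr (pwordP b). Qed.

Lemma lscan_chain r : r = r \th pcod a -> chain (wrev (wscan act r (wrev a))).
Proof.
move=> hr; rewrite chain_rev; apply: (chain_scan _ _).1 => //.
by rewrite chain_rev; apply: pwordP.
Qed.

Let p' : P := pdom b \th pcod a.
Let q' : P := pcod a \th pdom b.

Definition lfactor : ppath := PPath (lscan_chain (esym (thI (pcod a) (pdom b)))).
Definition rfactor : ppath := PPath (rscan_chain (esym (thI (pdom b) (pcod a)))).
Definition mfactor : ppath := path2 (relF_th (pcod a) (pdom b)).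

Lemma lm_ends : pcod lfactor = pdom mfactor.
Proof. by rewrite /pcod /= wlast_rev /= /act /pdom /= /pcod thI. Qed.

Lemma mr_ends : pcod (pcomp lm_ends) = pdom rfactor.
Proof. by rewrite /pcod /pdom /= /wlast /= last_cat /= /act thI. Qed.

Definition pmul : ppath := pcomp mr_ends.

Lemma pmulE : pword pmul = pmul_word a b.
Proof. by rewrite pmul_wordE. Qed.

End ProductFactors.

Lemma pmul_chain a b : chain (pmul_word a b).
Proof. by rewrite -pmulE; apply: pwordP. Qed.

Lemma pmul_congr a a' b b' :
  pcongr a a' -> pcongr b b' -> pcongr (pmul a b) (pmul a' b').
Proof.
move=> ha hb; have [_ ea] := pcongr_ends ha; have [eb _] := pcongr_ends hb.
apply: pc_comp; first apply: pc_comp.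
- have h := pcongr_rev ha.
  have -> : lfactor a b = ppath_rev (ppath_rev (lfactor a b)).
    by apply: ppath_inj; rewrite /= wrevK.
  have -> : lfactor a' b' = ppath_rev (ppath_rev (lfactor a' b')).
    by apply: ppath_inj; rewrite /= wrevK.
  apply: pcongr_rev.
  apply: (pcongr_restr h (r := pdom b \th pcod a)).
  + by rewrite /pdom /= -/(pcod a) thI.
  + by rewrite /= wrevK.
  + by rewrite /= wrevK -ea -eb.
- rewrite (_ : mfactor a b = mfactor a' b'); first exact: pc_refl.
  by apply: ppath_inj; rewrite /= ea eb.
apply: (pcongr_restr hb (r := pcod a \th pdom b)) => //.
- by rewrite thI.
- by rewrite /= ea eb.
Qed.

End PathCategory.

Section FreeRegularStarSemigroup.
Context (P : projAlgebra).

Definition PG : Type := quot (pcongr_equiv P).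
HB.instance Definition _ := Choice.copy PG (quot (pcongr_equiv P)).

Definition PG_cls (a : ppath P) : PG := cls (pcongr_equiv P) a.

Definition PG_mul (x y : PG) : PG := PG_cls (pmul (rep x) (rep y)).

Lemma PG_mulE (a b : ppath P) : PG_mul (PG_cls a) (PG_cls b) = PG_cls (pmul a b).
Proof. by apply/clsP; apply: pmul_congr; apply: rep_cls. Qed.

HB.instance Definition _ := hasMul.Build PG PG_mul.

Definition isE (x : PG) : Prop :=
  exists (p q : P) (h : relF p q), x = PG_cls (path2 h).

Definition E : Type := {x : PG | isE x}.

Definition proj (p : P) : PG := PG_cls (path1 p).

Lemma isE_proj (p : P) : isE (proj p).
Proof.
exists p, p, (relF_refl p); apply/clsP/pc_sym/pc_gen; exact: pr_id.
Qed.

Lemma isE_proj_mul (p q : P) : isE (proj p * proj q).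
Proof.
exists (q \th p), (p \th q), (relF_th p q).
rewrite [LHS]PG_mulE; congr PG_cls; apply: ppath_inj.
by rewrite pmulE /pmul_word /wcat /wrev /wlast /wscan /= /act !thI.
Qed.

Definition projE (p : P) : E := exist isE _ (isE_proj p).
Definition proj_mulE (p q : P) : E := exist isE _ (isE_proj_mul p q).

Definition basic_pair (e f : PG) : Prop :=
  [\/ e = e * f, e = f * e, f = e * f | f = f * e].

(* The alphabet X_E is E itself, x_e being [letter e].  In [rel_basic] the
   letter g stands for ef; such a g in E always exists, since ef is in E for
   every basic pair (e, f). *)
Inductive rel_E : word E -> word E -> Prop :=
| rel_basic (e f g : E) : basic_pair (sval e) (sval f) ->
    sval g = sval e * sval f -> rel_E (letters2 e f) (letter g)
| rel_proj (p q : P) :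
    rel_E (letters2 (projE p) (projE q)) (letter (proj_mulE p q)).

End FreeRegularStarSemigroup.

(* Main.v *)
Require Import Defs.
From HB Require Import structures.
From mathcomp Require Import all_boot.
From mathcomp Require Import boolp.

(** In the free regular star-semigroup, a path class is the product of the
    projections along the path: [[p_1, ..., p_k]] = p_1 ... p_k.  So the only
    possible morphism to the presented semigroup that inverts x_e |-> e sends
    [[p_1, ..., p_k]] to x_{p_1} ... x_{p_k}.

    Everything about this map follows from three laws for the elements
    X p = x_p: they are idempotent, X p X q = X p' X q' where p' = q theta_p
    and q' = p theta_q (both sides are x_{pq}, as pq = p'q'), and
    X p X q X p = X p when p F q (this one uses the basic pair (pq, p), whose
    product is p).  They make word products invariant under the path
    congruence ([wprod_pcongr]): if (e, f) is p-linked, the two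
    sides of the linked relation both become X e X p X f.  They also make word
    products compatible with the product of paths ([wprod_pmul]): the middle
    letters X p_k X q_1 are replaced by X p' X q', and the smaller projections
    p', q' are then absorbed outwards, which restricts every letter of the two
    words exactly as in the definition of the product.

    The inverse map evaluates a word over E in PG(P).  It is multiplicative
    once PG(P) is known to be associative ([PG_mulA]).  As the projections
    generate, associativity reduces to (a r) b = a (r b) for a projection r;
    there the two products are paths that differ in a single letter, and they
    are identified by one relation for an r-linked pair ([pmul_middleA]).

    The two maps are mutually inverse on generators: an idempotent
    e = [[p, q]] is sent to x_p x_q = x_{pq} = x_e. *)

Set Implicit Arguments.
Unset Strict Implicit.
Unset Printing Implicit Defensive.

Local Open Scope group_scope.

(** * Products of words in a semigroup *)

Section WordProduct.
Context (T : Type) (S : semigroupType) (f : T -> S).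
Implicit Types (u v : word T) (s : seq T).

Definition wprod u : S := foldl (fun a t => a * f t) (f u.1) u.2.

Lemma wprod_cat u v : wprod (wcat u v) = wprod u * wprod v.
Proof.
case: u v => x s [y t]; rewrite /wprod /wcat /= foldl_cat /=.
move: (foldl _ _ s) => a; elim: t (f y) => //= z t IH b.
by rewrite -mulgA IH.
Qed.

Lemma wprod_cons x y s : wprod (x, y :: s) = f x * wprod (y, s).
Proof. exact: (wprod_cat (letter x) (y, s)). Qed.

Lemma wprod_rev_cons x y s :
  wprod (wrev (x, y :: s)) = wprod (wrev (y, s)) * f x.
Proof.
rewrite -[f x]/(wprod (letter x)) -wprod_cat; congr wprod.
by rewrite /wcat /wrev /wlast /= rev_cons cats1.
Qed.

End WordProduct.

Lemma eq_wprod T (S : semigroupType) (f g : T -> S) u :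
  f =1 g -> wprod f u = wprod g u.
Proof.
move=> e; rewrite /wprod e; case: u => x s /=.
by elim: s (g x) => //= y s IH a; rewrite e IH.
Qed.

Lemma wprod_morph T (S S' : semigroupType) (f : T -> S) (h : S -> S') u :
  {morph h : a b / a * b} -> h (wprod f u) = wprod (h \o f) u.
Proof.
move=> hM; rewrite /wprod /=; elim: u.2 (f u.1) => //= y s IH a.
by rewrite IH hM.
Qed.

(** * Semigroup elements that multiply like projections *)

Section ProjectionLaws.
Context (P : projAlgebra) (S : semigroupType) (X : P -> S).
Hypothesis X_idem : forall p, X p * X p = X p.
Hypothesis X_swap : forall p q, X p * X q = X (q \th p) * X (p \th q).
Implicit Types (p q r : P) (u v : word P) (a b : ppath P).

Lemma wprod_last u : wprod X u * X (wlast u) = wprod X u.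
Proof.
case: u => x s; rewrite /wlast /=; elim: s x => [|y s IH] x /=.
  exact: X_idem.
by rewrite wprod_cons -mulgA IH.
Qed.

Lemma wprod_head u : X u.1 * wprod X u = wprod X u.
Proof.
case: u => x [|y s] /=; first exact: X_idem.
by rewrite wprod_cons mulgA X_idem.
Qed.

Lemma wprod_comp u v : wlast u = v.1 ->
  wprod X (wcomp u v) = wprod X u * wprod X v.
Proof.
case: v => y [|z s] /= h.
  by rewrite /wcomp cats0 -surjective_pairing -[wprod X (y, _)]/(X y) -h wprod_last.
rewrite wprod_cons mulgA -h wprod_last.
exact: (wprod_cat X u (z, s)).
Qed.

(** A projection r below p moves past the next projection q of a path by
    restricting it: q theta_r = r when p F q, so that the swap law leaves r in
    place and turns q into r theta_q. *)
Lemma X_restr p q r : relF p q -> r = r \th p ->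
  X r * X q = X r * X (r \th q) /\ X q * X r = X (r \th q) * X r.
Proof.
move=> hpq hr; have /relFP[e _] := relF_restr hpq hr.
have {}e : q \th r = r by rewrite -[LHS]thJ -e.
by rewrite [LHS]X_swap [X q * _]X_swap e.
Qed.

(** The restricted letters are produced one at a time: once r has restricted the
    first letter, the restriction of that letter acts on the second, and so on,
    which is the recursion that defines the scan. *)
Lemma wprod_restr r u : chain u -> r = r \th u.1 ->
  X r * wprod X u = wprod X (wscan (@act P) r u).
Proof.
case: u => x s; rewrite /chain /wscan /act /= => hs hr; rewrite -hr.
elim: s x r hs hr => [|y s IH] x r /=.
  by move=> _ hr; rewrite (X_restr (relF_refl x) hr).1 -hr X_idem.
case/andP=> hxy hs hr; rewrite [in RHS]wprod_cons.
rewrite wprod_cons mulgA (X_restr (relF_refl x) hr).1 -hr X_idem.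
(* The first letter of the tail is doubled: one copy is restricted by r, and
   idempotency absorbs the other. *)
rewrite -(IH y) ?thI // mulgA -(X_restr hxy hr).1.
by rewrite -mulgA (wprod_head (y, s)).
Qed.

(** The mirror image of [wprod_restr]: restriction from the right end is a scan
    of the reversed word. *)
Lemma wprod_rev_restr r u : chain u -> r = r \th u.1 ->
  wprod X (wrev u) * X r = wprod X (wrev (wscan (@act P) r u)).
Proof.
case: u => x s; rewrite /chain /wscan /act /= => hs hr; rewrite -hr.
elim: s x r hs hr => [|y s IH] x r /=.
  by move=> _ hr; rewrite [LHS](X_restr (relF_refl x) hr).2 -hr X_idem.
case/andP=> hxy hs hr; rewrite [in RHS]wprod_rev_cons.
rewrite wprod_rev_cons -mulgA (X_restr (relF_refl x) hr).2 -hr X_idem.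
rewrite -(IH y) ?thI // -mulgA -(X_restr hxy hr).2 mulgA.
by have /= := wprod_last (wrev (y, s)); rewrite wlast_rev /= => ->.
Qed.

Lemma wprod_pmul a b : wprod X (pmul_word a b) = wprod X a * wprod X b.
Proof.
rewrite /pmul_word wprod_cat -!wprod_restr ?pwordP ?thI // -wprod_rev_restr.
- rewrite wrevK mulgA -(mulgA (wprod X a)) -X_swap mulgA wprod_last.
  by rewrite -mulgA wprod_head.
- by rewrite chain_rev pwordP.
by rewrite thI.
Qed.

Hypothesis X_back : forall p q, relF p q -> X p * X q * X p = X p.

(** For a p-linked pair (e, f), p theta_e = e and p theta_f = f, so X e absorbs
    e theta_p into X p, and likewise on the side of f: both sides of the linked
    relation equal X e X p X f. *)
Lemma wprod_path_rel u v : path_rel u v -> wprod X u = wprod X v.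
Proof.
case=> [p|p q h|p e f h]; rewrite /wprod /= ?X_idem ?X_back //.
have absorb e' f' : linked p e' f' -> p \th e' = e'.
  by move/linked_relF/relFP=> [he _]; rewrite -[LHS]thJ -he.
have [he hf] := (absorb _ _ h, absorb _ _ (linkedC h)).
have -> : X e * X (e \th p) = X e * X p by rewrite [RHS]X_swap he.
have E : X (f \th p) * X f = X p * X f by rewrite [RHS]X_swap hf.
by rewrite -[RHS]mulgA E mulgA.
Qed.

Lemma wprod_pcongr a b : pcongr a b -> wprod X a = wprod X b.
Proof.
elim=> {a b} [a b /wprod_path_rel|a|a b _|a b c _ -> _|a a' b b' h h' _ ea _ eb] //.
by rewrite !wprod_comp // ea eb.
Qed.

End ProjectionLaws.

(** * Associativity of the product of paths *)

Section Associativity.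
Context (P : projAlgebra).
Implicit Types (p q r : P) (u v : word P) (a b : ppath P).

(** This pair is where the products (a r) b and a (r b) meet, when a ends at p
    and b starts at q. *)
Lemma pmul_linked p q r :
  linked r (q \th r \th p) (p \th r \th q).
Proof.
suff gen x y : y \th r \th x = x \th r \th y \th r \th (y \th r \th x).
  by split; apply: gen.
by rewrite !thT -!(thT r y) thI2 thJ.
Qed.

(** Words of the form A, x, B, where A ends at e and B starts at f, are
    decomposed as A o (e, x, f) o B, so that the linked relation applies to the
    middle factor. *)
Lemma wcat_linked (A B a b : ppath P) r e f :
  linked r e f -> pcod A = e -> pdom B = f ->
  pword a = wcat (wcat A (letter (e \th r))) B ->
  pword b = wcat (wcat A (letter (f \th r))) B -> pcongr a b.
Proof.
move=> hl hA hB ha hb; have [cu cv] := path_rel_chain (pr_linked hl).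
have hAu : pcod A = pdom (PPath cu) by [].
have hAv : pcod A = pdom (PPath cv) by [].
have last3 z : wlast (wcomp A (e, [:: z; f])) = pdom B.
  by rewrite /wlast /= last_cat.
have -> : a = Defs.pcomp (a := Defs.pcomp hAu) (b := B) (last3 _).
  apply: ppath_inj; rewrite ha /wcat -/(pdom B) hB.
  by rewrite /= /wcomp /= -!catA.
have -> : b = Defs.pcomp (a := Defs.pcomp hAv) (b := B) (last3 _).
  apply: ppath_inj; rewrite hb /wcat -/(pdom B) hB.
  by rewrite /= /wcomp /= -!catA.
apply: pc_comp; last exact: pc_refl.
by apply: pc_comp; [exact: pc_refl | apply: pc_gen; apply: pr_linked].
Qed.

(** If z = z theta_y, restricting by y and then by z is the same as restricting
    by z at once: z theta_{y theta_w} = (z theta_y) theta_w theta_y theta_w, where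
    the alternating product collapses to z theta_y theta_w = z theta_w, and this
    value in turn is fixed by theta_{y theta_w}. *)
Lemma scanl_act z y (s : seq P) : z = z \th y ->
  scanl (@act P) z (scanl (@act P) y s) = scanl (@act P) z s.
Proof.
elim: s z y => //= w s IH z y hz.
have e : z \th (y \th w) = z \th w by rewrite thT {1}hz thI2 -hz.
by rewrite /act e IH // thT thI -thT e.
Qed.

Lemma wscan_wscan z y u : z \th (y \th u.1) = z \th u.1 ->
  wscan (@act P) z (wscan (@act P) y u) = wscan (@act P) z u.
Proof.
case: u => x s; rewrite /wscan /= /act => e; rewrite e scanl_act //.
by rewrite thT thI -thT e.
Qed.

Lemma wrev_cat u v : wrev (wcat u v) = wcat (wrev v) (wrev u).
Proof.
case: u v => x s [y t]; rewrite /wcat /wrev /wlast /=.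
by rewrite last_cat belast_cat rev_cat /= rev_cons cat_rcons.
Qed.

Lemma wlast_cat u v : wlast (wcat u v) = wlast v.
Proof. by case: u v => x s [y t]; rewrite /wlast /wcat /= last_cat. Qed.

Lemma pmul_letter u r (p := wlast u) :
  pmul_word u (letter r) =
  wcat (wrev (wscan (@act P) (r \th p) (wrev u))) (letter (p \th r)).
Proof. by rewrite /pmul_word; congr wcat; rewrite /wscan /= /act thI. Qed.

Lemma letter_pmul u r (q := u.1) :
  pmul_word (letter r) u = wcat (letter (q \th r)) (wscan (@act P) (r \th q) u).
Proof. by rewrite /pmul_word /wrev /=; congr wcat; rewrite /wlast /= /act thI. Qed.

Lemma wscan_start z y u : z \th u.1 = y \th u.1 ->
  wscan (@act P) z u = wscan (@act P) y u.
Proof. by rewrite /wscan /act => ->. Qed.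

(** The product (a r) b restricts the letters of a twice, first along r and
    then along b, and a (r b) does so for the letters of b; double restrictions
    collapse, and what remains of the order of the products is the middle
    letter only: e theta_r here and f theta_r in [pmul_word_right], for
    e = q theta_r theta_p and f = p theta_r theta_q. *)
Lemma pmul_word_left u r v (p := wlast u) (q := v.1) :
  pmul_word (pmul_word u (letter r)) v =
  wcat (wcat (wrev (wscan (@act P) (q \th r \th p) (wrev u)))
             (letter (q \th r \th p \th r)))
       (wscan (@act P) (p \th r \th q) v).
Proof.
rewrite pmul_letter -/p /pmul_word wlast_cat wrev_cat wrevK -/q.
rewrite -[wlast _]/(p \th r).
(* The letter p theta_r contributed by r heads the reversed word, and the
   starting value of the scan is already restricted by it. *)
rewrite -[wscan _ _ (wcat _ _)]/(wcat (letter _) (wscan _ _ _)) [act _ _]thI.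
rewrite wrev_cat wscan_wscan; last by rewrite /= -/p !thT !thI !thI2.
rewrite (@wscan_start _ (q \th r \th p)); last by rewrite /= -/p !thT thI thI2.
by rewrite thT.
Qed.

Lemma pmul_word_right u r v (p := wlast u) (q := v.1) :
  pmul_word u (pmul_word (letter r) v) =
  wcat (wcat (wrev (wscan (@act P) (q \th r \th p) (wrev u)))
             (letter (p \th r \th q \th r)))
       (wscan (@act P) (p \th r \th q) v).
Proof.
rewrite letter_pmul -/q /pmul_word -/p.
change (wcat _ _).1 with (q \th r).
rewrite -[wscan _ _ (wcat _ _)]/(wcat (letter _) (wscan _ _ _)) [act _ _]thI.
rewrite wcatA wscan_wscan; last by rewrite /= -/q !thT !thI !thI2.
rewrite (@wscan_start (p \th (q \th r)) (p \th r \th q)); last by rewrite /= -/q !thT thI thI2.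
by rewrite thT.
Qed.

Lemma pmul_middleA a b r :
  pcongr (pmul (pmul a (path1 r)) b) (pmul a (pmul (path1 r) b)).
Proof.
set p := pcod a; set q := pdom b.
have he : q \th r \th p = q \th r \th p \th pcod a by rewrite -/p thI.
have hf : p \th r \th q = p \th r \th q \th pdom b by rewrite -/q thI.
apply: (@wcat_linked (PPath (lscan_chain he)) (PPath (rscan_chain hf)) _ _ r _ _
          (pmul_linked p q r)).
- by rewrite /pcod /= wlast_rev; exact: esym he.
- exact: esym hf.
- by rewrite pmulE [pword (pmul a _)]pmulE pmul_word_left.
by rewrite pmulE [pword (pmul _ b)]pmulE pmul_word_right.
Qed.

(** The letters of a path are F-related, so nothing is cut down. *)
Lemma wscan_id u : chain u -> wscan (@act P) u.1 u = u.
Proof.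
case: u => x s; rewrite /chain /wscan /= /act thpp => hs; congr (_, _).
elim: s x hs => //= y s IH x /andP[/relFP[_ hy] hs].
by rewrite -hy IH.
Qed.

Lemma PG_cls_cons a b p : relF p (pdom b) ->
  pword a = wcat (letter p) b -> PG_cls a = proj p * PG_cls b.
Proof.
move=> /relFP[h1 h2] ha; rewrite [RHS]PG_mulE; congr PG_cls.
apply: ppath_inj; rewrite pmulE ha /pmul_word -/(pdom b).
rewrite -[wlast _]/p -h1 -h2 wscan_id ?pwordP //.
by rewrite -[wrev _]/(letter (p \th p)) thpp.
Qed.

Lemma PG_ind (K : PG P -> Prop) : (forall p, K (proj p)) ->
  (forall p (c : PG P), K c -> K (proj p * c)) -> forall c : PG P, K c.
Proof.
move=> K1 KM c; rewrite -[c]repK -/(PG_cls _).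
case: (rep _) => -[x s]; elim: s x => [|y s IH] x hs.
  have -> : PPath hs = path1 x by apply: ppath_inj.
  exact: K1.
have := hs; rewrite {1}/chain /= => /andP[hxy hys].
by rewrite (@PG_cls_cons _ (@PPath P (y, s) hys) x) //; apply: KM.
Qed.

(** Light's associativity test: the elements z with (x z) y = x (z y) for all x
    and y are closed under products, so it is enough that they include the
    projections, which generate. *)
Lemma PG_mulA : associative (@PG_mul P).
Proof.
have middle r x y : PG_mul (PG_mul x (proj r)) y = PG_mul x (PG_mul (proj r) y).
  have [[a <-] [b <-]] : (exists a, PG_cls a = x) /\ (exists b, PG_cls b = y).
    by split; eexists; exact: repK.
  rewrite (PG_mulE a) (PG_mulE (path1 r)) (PG_mulE _ b) (PG_mulE a).
  by apply/clsP; exact: pmul_middleA.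
suff light (z x y : PG P) : PG_mul (PG_mul x z) y = PG_mul x (PG_mul z y).
  by move=> x y z; rewrite light.
elim/PG_ind: z x y => [r|r z IH] x y; first exact: middle.
by rewrite -[_ * z]/(PG_mul _ _) -middle IH middle IH.
Qed.

HB.instance Definition _ := Magma_isSemigroup.Build (PG P) PG_mulA.

End Associativity.

(** * The two morphisms between the free semigroup and its presentation *)

Section Presentation.
Context (P : projAlgebra).
Implicit Types (p q : P).

Lemma PG_cls_wprod (a : ppath P) : PG_cls a = wprod (@proj P) a.
Proof.
case: a => -[x s]; elim: s x => [|y s IH] x hs.
  by have -> : PPath hs = path1 x by apply: ppath_inj.
have := hs; rewrite {1}/chain /= => /andP[hxy hys].
by rewrite (@PG_cls_cons _ _ (@PPath P (y, s) hys) x) // IH wprod_cons.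
Qed.

Lemma proj_mul_relF p q (h : relF p q) : proj p * proj q = PG_cls (path2 h).
Proof. by rewrite PG_cls_wprod. Qed.

Lemma proj_mul p q : proj p * proj q = proj (q \th p) * proj (p \th q).
Proof.
rewrite (proj_mul_relF (relF_th p q)) [LHS]PG_mulE; congr PG_cls.
by apply: ppath_inj; rewrite pmulE letter_pmul /wscan /= /act thI.
Qed.

Lemma proj_idem p : proj p * proj p = proj p.
Proof.
rewrite (proj_mul_relF (relF_refl p)); apply/clsP/pc_gen; exact: pr_id.
Qed.

Lemma proj_back p q : relF p q -> proj p * proj q * proj p = proj p.
Proof.
move=> h; have c : chain (p, [:: q; p]) by rewrite /chain /= h relF_sym h.
have -> : proj p * proj q * proj p = PG_cls (PPath c) by rewrite PG_cls_wprod.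
by apply/clsP/pc_gen; exact: pr_back.
Qed.

Lemma E_val_inj (e f : E P) : sval e = sval f -> e = f.
Proof. by case: e f => c hc [d hd] /= e; apply: eq_exist. Qed.

Let Q := presented (@rel_E P).
Definition gen (e : E P) : Q := presented_cls (@rel_E P) (letter e).

Lemma gen_basic (e f g : E P) : basic_pair (sval e) (sval f) ->
  sval g = sval e * sval f -> gen e * gen f = gen g.
Proof.
move=> h hg; rewrite [LHS]presented_mulE; apply/clsP/gc_gen.
exact: rel_basic.
Qed.

Lemma gen_proj (p q : P) (g : E P) : sval g = proj p * proj q ->
  gen (projE p) * gen (projE q) = gen g.
Proof.
move=> hg; rewrite [LHS]presented_mulE; apply/clsP/gc_gen.
rewrite (_ : g = proj_mulE p q); last exact: E_val_inj.
exact: rel_proj.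
Qed.

Definition gen_word (u : word P) : Q := wprod (fun p => gen (projE p)) u.

Lemma gen_idem p : gen (projE p) * gen (projE p) = gen (projE p).
Proof. by apply: gen_proj; rewrite proj_idem. Qed.

Lemma gen_swap p q : gen (projE p) * gen (projE q) =
  gen (projE (q \th p)) * gen (projE (p \th q)).
Proof.
rewrite (@gen_proj _ _ (proj_mulE p q)) //; apply/esym/gen_proj.
exact: proj_mul.
Qed.

(** Here a relation of a basic pair is needed: (pq, p) is one, since
    (pq) p = [[p, q, p]] = p. *)
Lemma gen_back p q : relF p q ->
  gen (projE p) * gen (projE q) * gen (projE p) = gen (projE p).
Proof.
move=> h; rewrite (@gen_proj _ _ (proj_mulE p q)) //.
have e := proj_back h.
by apply: gen_basic; rewrite /= ?e //; apply: Or43; rewrite e.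
Qed.

Lemma presented_clsE (u : word (E P)) : presented_cls (@rel_E P) u = wprod gen u.
Proof.
case: u => x s; elim: s x => //= y s IH x.
by rewrite wprod_cons -IH [RHS]presented_mulE.
Qed.

Definition to_presented (c : PG P) : Q := gen_word (rep c).
Definition of_presented (y : Q) : PG P := wprod sval (rep y).

Lemma to_presented_cls (a : ppath P) : to_presented (PG_cls a) = gen_word a.
Proof.
exact: (wprod_pcongr gen_idem gen_swap gen_back (rep_cls (pcongr_equiv P) a)).
Qed.

Lemma to_presentedM c d : to_presented (c * d) = to_presented c * to_presented d.
Proof.
rewrite -[c * d]/(PG_cls _) to_presented_cls pmulE.
exact: wprod_pmul gen_idem gen_swap _ _.
Qed.

(** Evaluation in PG(P) respects the generated congruence because the defining
    relations hold there and, PG(P) being associative, evaluation turns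
    concatenation into product. *)
Lemma wprod_gen_congr (u v : word (E P)) :
  gen_congr (@rel_E P) u v -> wprod sval u = wprod sval v.
Proof.
elim=> {u v} [u v [e f g _ hg|p q] | | u v _ | u v w _ -> _ -> | u u' v v' _ hu _ hv] //.
by rewrite !wprod_cat hu hv.
Qed.

Lemma of_presented_cls u : of_presented (presented_cls (@rel_E P) u) = wprod sval u.
Proof. exact: (wprod_gen_congr (rep_cls (gen_congr_equiv _) u)). Qed.

Lemma of_presentedM y z : of_presented (y * z) = of_presented y * of_presented z.
Proof.
by rewrite -[y * z]/(presented_cls _ _) of_presented_cls wprod_cat.
Qed.

Lemma to_presentedK : cancel to_presented of_presented.
Proof.
move=> c; rewrite -[c]repK -/(PG_cls _) to_presented_cls.
rewrite (wprod_morph _ _ of_presentedM) PG_cls_wprod; apply: eq_wprod => p /=.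
by rewrite of_presented_cls.
Qed.

(** It suffices to look at a generator x_e with e = [[p, q]], which comes back
    as x_p x_q, and the relation for pq = e makes this x_e. *)
Lemma of_presentedK : cancel of_presented to_presented.
Proof.
move=> y; rewrite -[y]repK -/(presented_cls _ _) of_presented_cls presented_clsE.
rewrite (wprod_morph _ _ to_presentedM); apply: eq_wprod => e /=.
have [p [q [h he]]] := svalP e.
rewrite he to_presented_cls; apply: gen_proj.
by rewrite he proj_mul_relF.
Qed.

HB.instance Definition _ := isMultiplicative.Build (PG P) Q to_presented to_presentedM.

End Presentation.

Theorem theorem7p10 (P : projAlgebra) :
  exists f : {multiplicative PG P -> presented (@rel_E P)}, bijective f.
Proof.
exists (@to_presented P).
exact: Bijective (@to_presentedK P) (@of_presentedK P).
Qed.
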